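(* Let $\mathcal{R}$ be a $\ast$-ring with identity. The MP1-relation $\leq^{\dagger-}$ is a partial order on $\mathcal{R}^{\dagger}$.
   Context: A $\ast$-ring is an associative ring with an involution $\ast$, i.e. $(x^{\ast})^{\ast}=x$, $(x+y)^{\ast}=x^{\ast}+y^{\ast}$, $(xy)^{\ast}=y^{\ast}x^{\ast}$. The Moore-Penrose inverse $a^{\dagger}$ of $a\in\mathcal{R}$ is the (unique, if it exists) $x\in\mathcal{R}$ with $axa=a$, $xax=x$, $(ax)^{\ast}=ax$, $(xa)^{\ast}=xa$; $\mathcal{R}^{\dagger}$ is the set of all $a\in\mathcal{R}$ for which $a^{\dagger}$ exists. $a\{1\}=\{x\in\mathcal{R}: axa=a\}$. For $a\in\mathcal{R}^{\dagger}$, the set of MP1-inverses of $a$ is $a\{\dagger-\}=\{a^{\dagger}aa^{-}: a^{-}\in a\{1\}\}$. For $a\in\mathcal{R}^{\dagger}$ and $b\in\mathcal{R}$, $a\leq^{\dagger-}b$ means that there exists $a^{\dagger-}\in a\{\dagger-\}$ such that $a^{\dagger-}a=a^{\dagger-}b$ and $aa^{\dagger-}=ba^{\dagger-}$. *)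

(* Defs.v *)
From mathcomp Require Import all_boot all_algebra.

Set Implicit Arguments.
Unset Strict Implicit.
Unset Printing Implicit Defensive.

Import GRing.Theory.
Local Open Scope ring_scope.

(* The base structure is [pzRingType] (identity, possibly 0 = 1), so the zero
   ring is included. *)
Definition star_involution (R : pzRingType) (star : R -> R) : Prop :=
  [/\ forall x, star (star x) = x,
      forall x y, star (x + y) = star x + star y
    & forall x y, star (x * y) = star y * star x].

(* [moore_penrose star a x] reads "x is the Moore-Penrose inverse of a"; see
   [moore_penrose_uniq] below. *)
Definition moore_penrose (R : pzRingType) (star : R -> R) (a x : R) : Prop :=
  [/\ a * x * a = a,
      x * a * x = x,
      star (a * x) = a * x
    & star (x * a) = x * a].

Definition mp_invertible (R : pzRingType) (star : R -> R) (a : R) : Prop :=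
  exists x, moore_penrose star a x.

Definition inner_inverse (R : pzRingType) (a x : R) : Prop := a * x * a = a.

(* [mp1_inverse star a] is the set {a^+ a a^- : a^- in a{1}}; it is empty when
   a has no Moore-Penrose inverse a^+. *)
Definition mp1_inverse (R : pzRingType) (star : R -> R) (a y : R) : Prop :=
  exists ad am,
    [/\ moore_penrose star a ad, inner_inverse a am & y = ad * a * am].

Definition mp1_le (R : pzRingType) (star : R -> R) (a b : R) : Prop :=
  exists y, [/\ mp1_inverse star a y, y * a = y * b & a * y = b * y].

(* MathComp's [reflexive], [antisymmetric] and [transitive] only apply to
   boolean relations on a whole type. *)
Definition partial_order_on (T : Type) (D : T -> Prop) (r : T -> T -> Prop) :
    Prop :=
  [/\ forall a, D a -> r a a,
      forall a b, D a -> D b -> r a b -> r b a -> a = b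
    & forall a b c, D a -> D b -> D c -> r a b -> r b c -> r a c].

Lemma moore_penrose_uniq (R : pzRingType) (star : R -> R) (a x y : R) :
  star_involution star ->
  moore_penrose star a x -> moore_penrose star a y -> x = y.
Proof.
move=> [_ _ starM] [axa xax sax sxa] [aya yay say sya].
have eq_ax : a * x = a * y.
  by rewrite -sax -{1}aya -(mulrA (a * y)) starM sax say mulrA axa.
have eq_xa : x * a = y * a.
  rewrite -sxa -{1}aya.
  by rewrite -(mulrA a y a) mulrA starM sxa sya -mulrA (mulrA a) axa.
by rewrite -xax -mulrA eq_ax mulrA eq_xa yay.
Qed.

(* Main.v *)
Require Import Defs.
From mathcomp Require Import all_boot all_algebra.

(** The MP1-inverses of a Moore-Penrose invertible [a] are exactly the
    reflexive inner inverses [y] of [a] with [y a] Hermitian.  If [y] witnesses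
    [a <= b] and [z] witnesses [b <= c], then [a z b = a = b z a] as for the
    minus order, and [z a z] witnesses [a <= c]: the Hermitian projections
    satisfy [(y a) (z b) = y a], so applying [*] gives
    [z a = (z b) (y a) = y a], which is Hermitian. *)

Import GRing.Theory.
Local Open Scope ring_scope.

Lemma mp1_inverseP {R : pzRingType} {star : R -> R} {a y : R} :
    star_involution star -> mp_invertible star a ->
  mp1_inverse star a y <->
  [/\ a * y * a = a, y * a * y = y & star (y * a) = y * a].
Proof.
move=> [_ _ starM] [x mpx]; split.
  move=> [ad [am [[ada dad _ sda] ama ->]]].
  have ya : ad * a * am * a = ad * a by rewrite -!mulrA (mulrA a) ama.
  split; rewrite ?ya //; first by rewrite -(mulrA a) ya mulrA ada.
  by rewrite !mulrA dad.
case: (mpx) => axa xax _ sxa [aya yay sya].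
(* The given [y] itself serves as the inner inverse, so [x * a = y * a] suffices. *)
exists x, y; split => //.
have xa_ya : x * a * (y * a) = x * a by rewrite -mulrA (mulrA a) aya.
have ya_xa : y * a * (x * a) = y * a by rewrite -mulrA (mulrA a) axa.
(* The adjoint of [ya_xa] reverses the two projections: [y * a = x * a * (y * a)]. *)
have -> : x * a = y * a by rewrite -sya -ya_xa starM sxa sya xa_ya.
by rewrite yay.
Qed.

Lemma mp1_le_refl (R : pzRingType) (star : R -> R) (a : R) :
  mp_invertible star a -> mp1_le star a a.
Proof.
move=> [x mpx]; exists (x * a * x); split=> //.
by exists x, x; split=> //; case: mpx.
Qed.

(** If [y] and [z] witness the two relations, [a] is in [R b], so [a * z * b = a]; then
    [b * z = a * z] turns this product into [b * z * b = b]. *)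
Lemma mp1_le_anti (R : pzRingType) (star : R -> R) (a b : R) :
    star_involution star -> mp_invertible star a -> mp_invertible star b ->
  mp1_le star a b -> mp1_le star b a -> a = b.
Proof.
move=> starP Da Db [y [/(mp1_inverseP starP Da)[aya _ _] yab _]].
move=> [z [/(mp1_inverseP starP Db)[bzb _ _] _ bza]].
have ayb : a * y * b = a by rewrite -mulrA -yab mulrA.
have azb : a * z * b = a.
  by rewrite -[in LHS]ayb -!mulrA (mulrA b) bzb mulrA.
by rewrite -azb -bza bzb.
Qed.

Lemma mp1_le_trans (R : pzRingType) (star : R -> R) (a b c : R) :
    star_involution star -> mp_invertible star a -> mp_invertible star b ->
  mp1_le star a b -> mp1_le star b c -> mp1_le star a c.
Proof.
move=> starP Da Db [y [/(mp1_inverseP starP Da)[aya _ sya] yab ayb]].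
move=> [z [/(mp1_inverseP starP Db)[bzb zbz szb] zbc bzc]].
have a_ayb : a * y * b = a by rewrite -mulrA -yab mulrA.
have a_bya : b * y * a = a by rewrite -ayb.
have azb : a * z * b = a.
  by rewrite -[in LHS]a_ayb -!mulrA (mulrA b) bzb mulrA.
have bza : b * z * a = a by rewrite -[in LHS]a_bya !mulrA bzb.
have ya_zb : y * a * (z * b) = y * a by rewrite -mulrA (mulrA a) azb.
have zb_ya : z * b * (y * a) = z * a by rewrite -!mulrA (mulrA b) a_bya.
have za : z * a = y * a.
  by case: starP => _ _ starM; rewrite -zb_ya -szb -sya -starM ya_zb.
have aza : a * z * a = a by rewrite -mulrA za mulrA.
have wa : z * a * z * a = z * a by rewrite -!mulrA (mulrA a) aza.
have aw : a * (z * a * z) = a * z by rewrite !mulrA aza.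
(* By [aza], [z] is an inner inverse of [a], but perhaps not a reflexive one; [z * a * z] is
   reflexive. *)
exists (z * a * z); split.
- apply/(mp1_inverseP starP Da); split.
  + by rewrite aw.
  + by rewrite wa !mulrA wa.
  + by rewrite wa za.
- by rewrite wa -!mulrA -zbc (mulrA a) azb.
- by rewrite aw !mulrA -bzc bza.
Qed.

Theorem mainTheorem3 (R : pzRingType) (star : R -> R)
    (starP : star_involution star) :
  partial_order_on (mp_invertible star) (mp1_le star).
Proof.
split.
- by move=> a; apply: mp1_le_refl.
- by move=> a b; apply: mp1_le_anti.
- by move=> a b c Da Db _; apply: (mp1_le_trans _ _ _ _ _ starP Da Db).
Qed.
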